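(* Let $A=\{a_k : k\ge 1\}$ be a null sequence of real numbers such that $$\log\left(\frac{a_n}{a_{n+1}}\right)=e^{\varphi(n)}\qquad\text{for all } n\ge 1,$$ where $\varphi:\mathbb N\to\mathbb R$ is strictly increasing and $\frac{\varphi(n)}{n}\to 0$ as $n\to\infty$. Then there exists a Borel set $\mathcal E\subseteq\mathbb R$ of Hausdorff dimension $1$ that does not contain any nontrivial affine copy of $A\cup\{0\}$.
   Context: $\mathbb N=\{1,2,3,\dots\}$. A null sequence is an infinite sequence $A=\{a_k: k\ge 1\}$ with $a_k>0$ for all $k$, strictly decreasing to $0$. A nontrivial affine copy of a set $B\subseteq\mathbb R$ is a set of the form $x+\delta B=\{x+\delta b: b\in B\}$ with $x\in\mathbb R$ and $\delta\in\mathbb R\setminus\{0\}$. *)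

(* Defs.v *)
From mathcomp Require Import all_boot all_order all_algebra.
From mathcomp Require Import all_classical all_reals all_analysis.

Set Implicit Arguments.
Unset Strict Implicit.
Unset Printing Implicit Defensive.

Import Order.TTheory GRing.Theory Num.Theory.
Import numFieldNormedType.Exports.

Local Open Scope classical_set_scope.
Local Open Scope ring_scope.

(* Sequences are indexed by the positive integers: they are functions on [nat]
   whose value at 0 is irrelevant. *)

Definition null_sequence (R : realType) (a : nat -> R) : Prop :=
  [/\ forall k, (1 <= k)%N -> 0 < a k,
      forall j k, (1 <= j)%N -> (j < k)%N -> a k < a j
    & a k @[k --> \oo] --> (0 : R)].

Definition seq_range (R : realType) (a : nat -> R) : set R :=
  [set a k | k in [set k | (1 <= k)%N]].

Definition affine_image (R : realType) (x delta : R) (B : set R) : set R :=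
  [set x + delta * b | b in B].

Definition contains_nontrivial_affine_copy (R : realType) (E B : set R) : Prop :=
  exists x delta : R, delta != 0 /\ affine_image x delta B `<=` E.

(* [ereal_sup set0] is [-oo], hence the maximum with 0. *)
Definition diam (R : realType) (U : set R) : \bar R :=
  maxe 0%E (ereal_sup [set `|x - y|%:E | x in U & y in U]).

(* diam(U)^s with the usual conventions: the empty set contributes 0 for every
   s, including s = 0, and 0^0 = 1 for a singleton. *)
Definition diam_pow (R : realType) (s : R) (U : set R) : \bar R :=
  if U == set0 then 0%E else poweR (diam U) s.

(* Finite covers are included, since the members of a cover may be empty. *)
Definition hausdorff_premeasure (R : realType) (s d : R) (E : set R) : \bar R :=
  ereal_inf [set (\sum_(0 <= i <oo) diam_pow s (U i))%E |
             U in [set U : nat -> set R |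
                   (forall i, (diam (U i) <= d%:E)%E) /\
                   E `<=` \bigcup_i U i]].

Definition hausdorff_measure (R : realType) (s : R) (E : set R) : \bar R :=
  ereal_sup [set hausdorff_premeasure s d E | d in [set d : R | 0 < d]].

Definition hausdorff_dim (R : realType) (E : set R) : \bar R :=
  ereal_inf [set s%:E | s in [set s : R | 0 <= s /\ hausdorff_measure s E = 0%E]].

(* Main.v *)
Require Import Defs.
From mathcomp Require Import all_boot all_order all_algebra.
From mathcomp Require Import all_classical all_reals all_analysis.
From mathcomp Require Import zify ring lra.

Import Order.TTheory GRing.Theory Num.Theory.
Import numFieldNormedType.Exports.

Local Open Scope classical_set_scope.
Local Open Scope ring_scope.

(** The set is cut out by a digit condition.  Fix integers r_n >= 2 with
    partial products Q_n = r_0 ... r_(n-1), and let E consist of the points of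
    [0, 1] that, for every n, lie within 2 / Q_(n+1) to the right of a multiple
    of 1 / Q_n.  This constrains nothing when r_n = 2; when r_n is large, it
    says that E has holes: two points of E are at distance at most 2 / Q_(n+1)
    or at least 1 / Q_n - 2 / Q_(n+1) ([gap_set_dist]).

    So if, for some n and k, the number |delta| a_k falls strictly between
    these two bounds, then x and x + delta a_k are not both in E.  It suffices
    to arrange that r_n takes large values 2 * 4^(j+1) (j = 0, 1, 2, ...) at
    scales n for which some a_k Q_n is comparable to 2^-j: the forbidden window
    for |delta| a_k Q_n is then about ]4^-(j+1), 1[, with 2^-j in its middle on
    a logarithmic scale, and for j large the factor |delta| cannot push
    a_k Q_n out of it ([gap_set_avoids]).

    Such scales exist arbitrarily far out, because a_k tends to 0 and Q_n
    doubles at each ordinary step ([scale_hit]).  Hence they can be chosen so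
    sparse that Q_n is at most C_eps 2^((1 + eps) n) for every eps > 0.  Sending
    a real with binary digits b_i to the real with digit b_i in the i-th
    place of the mixed radix system (r_i) maps [0, 1[ into E ([digit_map]).
    Two reals at distance at least 2 / 2^n have images at distance at least
    1 / Q_n, so the inverse of this map is Hoelder of every exponent s < 1
    ([digit_map_holder], [denom_ratio_pow]).  A cover of E therefore pulls back
    to a cover of [0, 1[ whose total length is at most a constant times the sum
    of the diam^s, which bounds that sum below ([hausdorff_dim_ge1]) and gives
    dimension 1. *)

(** * Bounding Hausdorff dimension *)

Section HausdorffDimension.
Context {R : realType}.
Implicit Types (U E : set R) (s : R).

Lemma diam_ge0 U : (0 <= diam U)%E.
Proof. by rewrite /diam le_max lexx. Qed.

Lemma dist_le_diam U x y : U x -> U y -> (`|x - y|%:E <= diam U)%E.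
Proof.
move=> Ux Uy; rewrite /diam le_max; apply/orP; right.
by apply: ereal_sup_ubound; exists x => //; exists y.
Qed.

Lemma diam_pow_ge0 s U : (0 <= diam_pow s U)%E.
Proof. by rewrite /diam_pow; case: ifP => // _; exact: poweR_ge0. Qed.

Lemma dist_pow_le_diam_pow s U x y : 0 <= s -> U x -> U y ->
  ((`|x - y| `^ s)%:E <= diam_pow s U)%E.
Proof.
move=> s0 Ux Uy; rewrite /diam_pow ifF; last by apply/negbTE/set0P; exists x.
rewrite -poweR_EFin; apply: gt0_ler_poweR => //; rewrite ?in_itv /= ?leey ?andbT.
- by rewrite lee_fin normr_ge0.
- by rewrite diam_ge0.
- exact: dist_le_diam.
Qed.

Lemma diam_le U (c : R) : 0 <= c -> (forall x y, U x -> U y -> `|x - y| <= c) ->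
  (diam U <= c%:E)%E.
Proof.
move=> c0 Uc; rewrite /diam ge_max lee_fin c0 /=.
by apply: ge_ereal_sup => _ [x Ux [y Uy <-]]; rewrite lee_fin Uc.
Qed.

Lemma diam_pow_le s U (c : R) : 0 <= s -> 0 <= c -> (diam U <= c%:E)%E ->
  (diam_pow s U <= (c `^ s)%:E)%E.
Proof.
move=> s0 c0 Uc; rewrite /diam_pow; case: ifP => _.
  by rewrite lee_fin powR_ge0.
rewrite -poweR_EFin; apply: gt0_ler_poweR => //; rewrite ?in_itv /= ?leey ?andbT.
- by rewrite diam_ge0.
- by rewrite lee_fin.
Qed.

(** Mass distribution without a measure on [E]: the hypothesis says that the
    inverse of [g] is Hoelder of exponent s, so covers of [E] pull back to covers
    of [0, 1[ and Lebesgue measure gives the lower bound. *)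
Lemma hausdorff_dim_ge1 E (g : R -> R) :
  (forall u : R, 0 <= u < 1 -> E (g u)) ->
  (forall s, 0 <= s < 1 -> exists C : R, forall u v : R, 0 <= u < 1 -> 0 <= v < 1 ->
     `|u - v| <= C * `|g u - g v| `^ s) ->
  (1 <= hausdorff_dim E)%E.
Proof.
move=> gE gH; apply: le_ereal_inf_tmp => _ [s [s0 HE] <-].
rewrite lee_fin leNgt; apply/negP => s1.
have [C0 C0P] := gH s (introT andP (conj s0 s1)).
pose C := Num.max C0 1.
have C_gt0 : 0 < C by rewrite lt_max ltr01 orbT.
have CP u v : 0 <= u < 1 -> 0 <= v < 1 -> `|u - v| <= C * `|g u - g v| `^ s.
  move=> u01 v01; apply: le_trans (C0P u v u01 v01) _.
  by apply: ler_wpM2r; rewrite ?powR_ge0// le_max lexx.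
(* A cover so efficient that the pulled back intervals have total length less
   than 1. *)
have : (hausdorff_premeasure s 1 E < ((2 * C)^-1)%:E)%E.
  apply: (@le_lt_trans _ _ 0%E); last by rewrite lte_fin invr_gt0 mulr_gt0.
  by rewrite -HE; apply: ereal_sup_ubound; exists 1 => //=; exact: ltr01.
move=> /ereal_inf_lt [_ [U [_ EU] <-] Ulte].
pose F i : R := fine (diam_pow s (U i)).
have UF i : diam_pow s (U i) = (F i)%:E.
  rewrite /F fineK// ge0_fin_numE ?diam_pow_ge0// ltey; apply/eqP => Uoo.
  suff : (\sum_(0 <= i <oo) diam_pow s (U i))%E = +oo%E.
    by move=> Soo; move: Ulte; rewrite Soo.
  by apply: (@nneseries_pinfty _ _ _ i) => // n _; exact: diam_pow_ge0.
have F_ge0 i : 0 <= F i by rewrite -lee_fin -UF diam_pow_ge0.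
pose V i := [set u | 0 <= u < 1 /\ U i (g u)].
(* A preimage of a member of the cover lies in an interval centred at any of
   its points. *)
have /choice[I IP] i : exists I : interval R, V i `<=` [set` I] /\
    (lebesgue_measure [set` I] <= (2 * C)%:E * diam_pow s (U i))%E.
  have [->|/set0P[u0 [u0P Uu0]]] := eqVneq (V i) set0.
    exists `[0, 0[%R; split; first by [].
    rewrite set_itvxx measure0 mule_ge0 ?diam_pow_ge0// lee_fin.
    by rewrite mulr_ge0// ltW.
  exists `[u0 - C * F i, u0 + C * F i]%R; split.
    move=> v [vP Uv] /=; rewrite in_itv/= -ler_distlC.
    apply: le_trans (CP _ _ u0P vP) _.
    apply: ler_wpM2l; first exact: ltW.
    by rewrite -lee_fin -UF; exact: dist_pow_le_diam_pow.
  have CF0 : 0 <= C * F i by rewrite mulr_ge0// ltW.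
  rewrite lebesgue_measure_itv/= UF; case: ifP => _.
    by rewrite -EFinB -EFinM lee_fin; lra.
  by rewrite -EFinM lee_fin; lra.
(* The intervals cover [0, 1[, so their total length is at least 1. *)
have : (lebesgue_measure (`[0%R, 1%R[%classic : set R) <=
        \sum_(0 <= i <oo) lebesgue_measure [set` I i])%E.
  apply: measure_sigma_subadditive => //.
  move=> u /=; rewrite in_itv/= => u01; have [i _ Ui] := EU _ (gE _ u01).
  by exists i => //; apply: (IP i).1.
apply/negP; rewrite -ltNge lebesgue_measure_itv/= lte_fin ltr01 oppr0 adde0.
apply: (@le_lt_trans _ _ (\sum_(0 <= i <oo) ((2 * C)%:E * diam_pow s (U i)))%E).
  by apply: lee_nneseries => // i _; exact: (IP i).2.
rewrite nneseriesZl; last by move=> i _; exact: diam_pow_ge0.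
rewrite muleC -lte_pdivlMr ?mulr_gt0//; by rewrite mul1e.
Qed.

(** For s = 1 + eps, covering by N + 1 intervals of length 1 / N costs
    (N + 1) N^-s <= 2 N^-eps. *)
Lemma hausdorff_dim_le1 E : E `<=` `[0, 1]%classic -> (hausdorff_dim E <= 1)%E.
Proof.
move=> E01; apply/lee_addgt0Pr => eps eps0.
pose s := 1 + eps; have s0 : 0 <= s by rewrite /s; lra.
apply: ereal_inf_lbound; exists s => //; split => //.
have pre_ge0 d : (0 <= hausdorff_premeasure s d E)%E.
  apply: le_ereal_inf_tmp => _ [U _ <-].
  by apply: nneseries_ge0 => i _ _; exact: diam_pow_ge0.
apply/eqP; rewrite eq_le; apply/andP; split; last first.
  apply: (le_trans (pre_ge0 1)); apply: ereal_sup_ubound.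
  by exists 1 => //=; exact: ltr01.
apply: ge_ereal_sup => _ [d /= d0 <-].
apply/lee_addgt0Pr => e e0; rewrite add0e.
(* N > b makes 1 / N <= d and 2 N^-eps <= e. *)
pose b := Num.max d^-1 ((2 / e) `^ eps^-1).
pose N := (Num.truncn b).+1.
have bN : b < N%:R by exact: truncnS_gt.
have N0 : 0 < N%:R :> R by rewrite ltr0n.
pose U i := if (i <= N)%N then `[i%:R / N%:R, i.+1%:R / N%:R]%classic
            else set0 : set R.
have Udiam i : (diam (U i) <= (N%:R^-1)%:E)%E.
  apply: diam_le; first by rewrite invr_ge0 ltW.
  move=> x y; rewrite /U; case: ifP => // _ /=; rewrite !in_itv/= -natr1 mulrDl.
  by rewrite mul1r => /andP[? ?] /andP[? ?]; rewrite ler_norml; lra.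
apply: (@le_trans _ _ (\sum_(0 <= i <oo) diam_pow s (U i))%E).
  apply: ereal_inf_lbound; exists U => //; split.
    move=> i; apply: le_trans (Udiam i) _; rewrite lee_fin.
    rewrite -[leRHS]invrK lef_pV2 ?posrE ?invr_gt0//.
    by apply: le_trans (ltW bN); rewrite le_max lexx.
  move=> x /E01 /=; rewrite in_itv/= => /andP[x0 x1].
  have xN0 : 0 <= x * N%:R by rewrite mulr_ge0// ltW.
  exists (Num.truncn (x * N%:R)) => //; rewrite /U ifT.
    rewrite /= in_itv/= ler_pdivrMr// ler_pdivlMr//.
    by have /andP[-> /ltW ->] := truncn_itv xN0.
  rewrite -(ler_nat R); have /andP[+ _] := truncn_itv xN0.
  move/le_trans; apply; nra.
rewrite (nneseries_split 0 N.+1); last by move=> *; exact: diam_pow_ge0.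
rewrite add0n eseries0 ?adde0; last first.
  by move=> i iN _; rewrite /U leqNgt iN /diam_pow eqxx.
apply: (@le_trans _ _ (\sum_(0 <= k < N.+1) ((N%:R^-1 : R) `^ s)%:E)%E).
  by apply: lee_sum => i _; apply: diam_pow_le => //; rewrite invr_ge0 ltW.
rewrite sumEFin lee_fin sumr_const_nat subn0 -[_ *+ N.+1]mulr_natl.
have Ninv : (N%:R^-1 : R) `^ s = N%:R^-1 * (N%:R `^ eps)^-1.
  rewrite -powR_inv1 ?ltW// -powRrM mulN1r powRN /s powRD; last by apply/implyP => _; rewrite gt_eqF.
  by rewrite powRr1 ?ltW// invfM powR_inv1// ltW.
rewrite Ninv.
have P0 : 0 < (N%:R : R) `^ eps by rewrite powR_gt0.
have Pe : 2 / e <= (N%:R : R) `^ eps.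
  have -> : 2 / e = ((2 / e) `^ eps^-1) `^ eps.
    by rewrite -powRrM mulVf ?gt_eqF// powRr1// divr_ge0// ltW.
  apply: ge0_ler_powR; rewrite ?nnegrE ?powR_ge0 ?(ltW eps0)// ltW//.
  by apply: le_lt_trans bN; rewrite le_max lexx orbT.
have N1 : (1 : R) <= N%:R by rewrite ler1n.
rewrite mulrA ler_pdivrMr// ler_pdivrMr// -natr1.
move: Pe; rewrite ler_pdivrMr// => Pe.
rewrite mulrAC; have -> : e * N%:R * N%:R `^ eps = N%:R * (N%:R `^ eps * e) by ring.
nra.
Qed.

End HausdorffDimension.

(** * Spreading binary digits over a mixed radix system *)

Section DigitSpreading.
Set Implicit Arguments.
Unset Strict Implicit.
Variable r : nat -> nat.
Hypothesis r_ge2 : forall n, (2 <= r n)%N.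

Definition denom n := (\prod_(i < n) r i)%N.

(** Reads the n binary digits of [k] as digits of the radix system [r]; bits of
    [k] beyond the n-th are kept as the leading digit, with no reduction, which
    keeps [spread n] strictly increasing on all of [nat]. *)
Fixpoint spread n k : nat :=
  if n is m.+1 then (r m * spread m k./2 + odd k)%N else k.

Lemma denomS n : denom n.+1 = (r n * denom n)%N.
Proof. by rewrite /denom big_ord_recr /= mulnC. Qed.

Lemma denom_gt0 n : (0 < denom n)%N.
Proof. by rewrite prodn_gt0// => i; exact: leq_trans (r_ge2 i). Qed.

Lemma spread_ltn n : {homo spread n : k l / (k < l)%N}.
Proof.
elim: n => // n IHn k l kl /=.
have rn := r_ge2 n.
have : (k./2 <= l./2)%N by exact/half_leq/ltnW.
rewrite leq_eqVlt => /predU1P[kl2|/IHn kl2].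
  have := odd_double_half k; have := odd_double_half l; rewrite kl2.
  by case: (odd k); case: (odd l) => /=; lia.
have : (r n * (spread n k./2).+1 <= r n * spread n l./2)%N by rewrite leq_mul2l kl2 orbT.
rewrite mulnS; case: (odd k); case: (odd l) => /=; lia.
Qed.

Context {R : realType}.
Implicit Types (u v x t : R).

Lemma denom_gt0R n : 0 < (denom n)%:R :> R.
Proof. by rewrite ltr0n denom_gt0. Qed.

Definition approx u n : R := (spread n (Num.truncn (2 ^+ n * u)))%:R / (denom n)%:R.

(** The truncations [approx u n] increase with n, so the supremum is their
    limit: the real with the binary digits of [u] in the radix system [r]. *)
Definition digit_map u : R := sup (range (approx u)).

Lemma half_truncn_double u : 0 <= u -> (Num.truncn (2 * u))./2 = Num.truncn u.
Proof.
move=> u0; apply/esym/truncn_def.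
have := truncn_itv (mulr_ge0 (ler0n R 2) u0).
set k := Num.truncn _; have := odd_double_half k.
move: (k./2) (odd k) => h b <- /andP[+ +].
rewrite -!natr1 natrD -muln2 natrM => uge ult; apply/andP; split.
  by have b0 : 0 <= (b%:R : R) := ler0n R b; lra.
have b1 : (b%:R : R) <= 1 by rewrite lern1 leq_b1.
by lra.
Qed.

Lemma approxS u n : 0 <= u -> exists b : bool,
  approx u n.+1 = approx u n + b%:R / (denom n.+1)%:R.
Proof.
move=> u0; exists (odd (Num.truncn (2 ^+ n.+1 * u))).
rewrite /approx /= exprS -mulrA half_truncn_double; last by rewrite mulr_ge0// exprn_ge0.
rewrite natrD mulrDl natrM denomS natrM; congr (_ + _).
have r0 : (r n)%:R != 0 :> R by rewrite pnatr_eq0 -lt0n (leq_trans _ (r_ge2 n)).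
by rewrite -mulf_div divff// mul1r.
Qed.

Lemma inv_denomS n : 2 * ((denom n.+1)%:R : R)^-1 <= (denom n)%:R^-1.
Proof.
rewrite denomS natrM invfM mulrA ler_piMl ?invr_ge0//.
have rn : 2 <= (r n)%:R :> R by rewrite ler_nat.
by rewrite ler_pdivrMr ?mul1r//; lra.
Qed.

(** Together with the next lemma: the intervals
    [approx u n, approx u n + 1 / Q_n] are nested. *)
Lemma approx_nondecreasing u : 0 <= u -> {homo approx u : m n / (m <= n)%N >-> m <= n}.
Proof.
move=> u0; apply: homo_leq => [x|x y z|n]; [exact: lexx|exact: le_trans|].
by have [b ->] := approxS n u0; rewrite lerDl divr_ge0.
Qed.

Lemma approx_gap_nonincreasing u : 0 <= u ->
  {homo (fun n => approx u n + (denom n)%:R^-1) : m n / (m <= n)%N >-> n <= m}.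
Proof.
move=> u0; apply: homo_leq => [x|x y z|n]; [exact: lexx|by move=> xy yz; exact: le_trans yz xy|].
have [b ->] := approxS n u0; rewrite -addrA lerD2l.
apply: le_trans (inv_denomS n); rewrite [2 * _]mulr_natl mulr2n lerD2r.
by rewrite ler_piMl ?invr_ge0// lern1 leq_b1.
Qed.

Lemma digit_map_itv u n : 0 <= u ->
  approx u n <= digit_map u <= approx u n + (denom n)%:R^-1.
Proof.
move=> u0.
have ub m : approx u m <= approx u n + (denom n)%:R^-1.
  have [mn|/ltnW nm] := leqP m n.
    apply: (le_trans (approx_nondecreasing u0 mn)).
    by rewrite lerDl invr_ge0.
  apply: le_trans (approx_gap_nonincreasing u0 nm).
  by rewrite lerDl invr_ge0.
apply/andP; split.
  apply: ub_le_sup; last by exists n.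
  by exists (approx u n + (denom n)%:R^-1) => _ [m _ <-].
apply: ge_sup; first by exists (approx u 0), 0%N.
by move=> _ [m _ <-].
Qed.

Definition gap_set : set R := `[0, 1]%classic `&`
  \bigcap_n \bigcup_(m : nat)
    `[m%:R / (denom n)%:R, m%:R / (denom n)%:R + 2 / (denom n.+1)%:R]%classic.

Lemma measurable_gap_set : measurable gap_set.
Proof.
apply: measurableI => //; apply: bigcap_measurable => // n _.
exact: bigcup_measurable.
Qed.

(** The n-th digit is 0 or 1 although r_n values are available, so the tail of
    [digit_map u] from position n on is at most 2 / Q_(n+1). *)
Lemma digit_map_gap_set u : 0 <= u < 1 -> gap_set (digit_map u).
Proof.
move=> /andP[u0 u1]; split.
  have := digit_map_itv 0 u0; rewrite /approx /= expr0 mul1r.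
  rewrite (@truncn_def _ u 0) ?u0//.
  by rewrite mul0r add0r /denom big_ord0 invr1 in_itv.
move=> n _; exists (spread n (Num.truncn (2 ^+ n * u))) => //=.
have /andP[g1 _] := digit_map_itv n u0.
have /andP[_] := digit_map_itv n.+1 u0; have [b ->] := approxS n u0.
rewrite in_itv/= g1 /= => /le_trans; apply.
rewrite -addrA lerD2l [2 * _]mulr_natl mulr2n lerD2r.
by rewrite ler_piMl ?invr_ge0// lern1 leq_b1.
Qed.

(** Such [u] and [v] are separated by at least two steps of the grid of mesh
    2^-n.  [spread n] being strictly increasing on integers, their truncations
    differ by at least 2 / Q_n; one of these two units absorbs the tail of
    [u]. *)
Lemma digit_map_expand u v n : 0 <= u -> 2 / 2 ^+ n <= v - u ->
  (denom n)%:R^-1 <= digit_map v - digit_map u.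
Proof.
move=> u0; have p0 : 0 < 2 ^+ n :> R by rewrite exprn_gt0.
have i0 : 0 < 2 / 2 ^+ n :> R by rewrite divr_gt0.
move=> uv; have v0 : 0 <= v by lra.
have /andP[gv _] := digit_map_itv n v0.
have /andP[_ gu] := digit_map_itv n u0.
suff : approx u n + 2 * (denom n)%:R^-1 <= approx v n by lra.
rewrite /approx -mulrDl ler_pM2r ?invr_gt0 ?denom_gt0R// -natrD ler_nat.
set k := Num.truncn _; set l := Num.truncn _.
have kl : (k.+2 <= l)%N.
  rewrite -ltnS -(ltr_nat R).
  have := truncn_itv (mulr_ge0 (ltW p0) u0); rewrite -/k => /andP[ku _].
  have := truncn_itv (mulr_ge0 (ltW p0) v0); rewrite -/l => /andP[_].
  apply: le_lt_trans; move: uv; rewrite ler_pdivrMr//; rewrite -[k.+2]addn2 natrD; lra.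
have := spread_ltn n (ltnSn k); have := spread_ltn n (ltnSn k.+1).
move: kl; rewrite leq_eqVlt => /predU1P[<-|/(spread_ltn n)]; lia.
Qed.

(** Compare |u - v| with the first n for which 2 / 2^n <= |u - v|; then
    |u - v| < 4 / 2^n while the images are at distance at least 1 / Q_n. *)
Lemma digit_map_holder s (C : R) : 0 <= s ->
  (forall n, (denom n)%:R `^ s <= C * 2 ^+ n) ->
  forall u v, 0 <= u < 1 -> 0 <= v < 1 ->
  `|u - v| <= 4 * C * `|digit_map u - digit_map v| `^ s.
Proof.
move=> s0 CP.
have C0 : 0 <= C.
  by have := CP 0%N; rewrite expr0 mulr1; apply: le_trans; exact: powR_ge0.
suff H u v : 0 <= u -> u < v -> v < 1 ->
    `|v - u| <= 4 * C * `|digit_map v - digit_map u| `^ s.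
  move=> u v /andP[u0 u1] /andP[v0 v1]; case: (ltgtP u v) => [uv|vu|->].
  - by rewrite distrC [X in X `^ s]distrC; exact: H.
  - exact: H.
  - by rewrite subrr normr0 mulr_ge0 ?powR_ge0// mulr_ge0.
move=> u0 uv v1; have d0 : 0 < v - u by rewrite subr_gt0.
have ex : exists n, 2 / 2 ^+ n <= v - u.
  exists (Num.truncn (2 / (v - u))).+1.
  set n := Num.truncn _.
  rewrite ler_pdivrMr ?exprn_gt0// mulrC -ler_pdivrMr//.
  apply: (@le_trans _ _ n.+1%:R); first exact/ltW/truncnS_gt.
  by rewrite -natrX ler_nat; exact/ltnW/ltn_expl.
case: (ex_minnP ex) => -[|n] nP nmin.
  by move: nP; rewrite expr0 divr1; lra.
have nlt : v - u < 2 / 2 ^+ n.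
  by rewrite ltNge; apply/negP => /nmin; rewrite ltnn.
have gap := digit_map_expand u0 nP.
have Q0 := denom_gt0R n.+1.
have gap0 : 0 <= digit_map v - digit_map u.
  by apply: le_trans gap; rewrite invr_ge0 ltW.
rewrite !ger0_norm ?(ltW d0)//.
have pow : ((denom n.+1)%:R `^ s)^-1 <= (digit_map v - digit_map u) `^ s.
  rewrite -powRN -[- s]mulN1r powRrM powR_inv1 ?ler0n//.
  by apply: ge0_ler_powR => //; rewrite nnegrE// invr_ge0 ltW.
have Qs : 0 < (denom n.+1)%:R `^ s :> R by exact: powR_gt0.
have p0 : 0 < 2 ^+ n :> R by rewrite exprn_gt0.
have key : v - u <= 4 * C / (denom n.+1)%:R `^ s.
  rewrite ler_pdivlMr//; have := CP n.+1; rewrite exprS.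
  move: nlt; rewrite ltr_pdivlMr//; nra.
apply: (le_trans key); apply: ler_wpM2l => //; by rewrite mulr_ge0.
Qed.

(** Both points are just to the right of multiples of 1 / Q_n: either of the
    same one, or of two different ones. *)
Lemma gap_set_dist n x y : gap_set x -> gap_set y ->
  `|y - x| <= 2 / (denom n.+1)%:R \/
  (denom n)%:R^-1 - 2 / (denom n.+1)%:R <= `|y - x|.
Proof.
wlog xy : x y / x <= y.
  move=> H Ex Ey; have [/H|/ltW/H] := leP x y; first exact.
  by rewrite distrC; exact.
move=> [_ /(_ n I)[l _ /=]] + [_ /(_ n I)[m _ /=]]; rewrite !in_itv/=.
set w := 2 / _; move=> /andP[lx xl] /andP[my ym].
rewrite ger0_norm ?subr_ge0//.
have [ml|lm] := leqP m l.
  left; suff : (m%:R / (denom n)%:R : R) <= l%:R / (denom n)%:R by lra.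
  by rewrite ler_pM2r ?invr_gt0 ?denom_gt0R// ler_nat.
right; suff : (l%:R / (denom n)%:R : R) + (denom n)%:R^-1 <= m%:R / (denom n)%:R by lra.
rewrite -[X in _ + X]mul1r -mulrDl natr1.
by rewrite ler_pM2r ?invr_gt0 ?denom_gt0R// ler_nat.
Qed.

End DigitSpreading.

(** * Choosing the radices from the sequence *)

Section Scales.
Set Implicit Arguments.
Unset Strict Implicit.
Context {R : realType}.
Variable a : nat -> R.

(** With [c = Q_n / 2^n], the two conditions under which the j-th large radix is
    used at position n.  The second puts an element of the sequence in the
    middle of the hole that it creates; the first delays it until the resulting
    value c' of Q_(n+1) / 2^(n+1) satisfies c'^j <= 2^n, which makes this factor
    grow more slowly than every exponential. *)
Definition trigger n c j : bool :=
  `[< ((c * 4 ^ j.+1) ^ j <= 2 ^ n)%N /\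
      exists2 k, (1 <= k)%N & 2 ^- j.+1 < a k * (2 ^ n * c)%:R <= 2 ^- j >].

(** The pair of [Q_n / 2^n] and the number of large radices used before n: each
    is used at the first opportunity. *)
Fixpoint scale_state n : nat * nat :=
  if n is m.+1 then
    let: (c, j) := scale_state m in
    if trigger m c j then ((c * 4 ^ j.+1)%N, j.+1) else (c, j)
  else (1%N, 0%N).

Definition loss n := (scale_state n).1.
Definition stage n := (scale_state n).2.
Definition triggered n := trigger n (loss n) (stage n).
Definition ratio n := (2 * (if triggered n then 4 ^ (stage n).+1 else 1))%N.

Lemma lossS n : loss n.+1 = (loss n * if triggered n then 4 ^ (stage n).+1 else 1)%N.
Proof.
rewrite /loss /triggered /loss /stage /=.
by case: (scale_state n) => c j /=; case: ifP => //=; rewrite muln1.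
Qed.

Lemma stageS n : stage n.+1 = (stage n + triggered n)%N.
Proof.
rewrite /triggered /stage /loss /=.
by case: (scale_state n) => c j /=; case: ifP => //=; rewrite ?addn1 ?addn0.
Qed.

Lemma ratio_ge2 n : (2 <= ratio n)%N.
Proof. by rewrite /ratio leq_pmulr//; case: ifP => // _; rewrite expn_gt0. Qed.

Lemma denom_ratio n : denom ratio n = (2 ^ n * loss n)%N.
Proof.
elim: n => [|n IHn]; first by rewrite /denom big_ord0.
by rewrite denomS IHn /ratio lossS (expnS 2 n) (mulnC (loss n)) mulnACA.
Qed.

Lemma loss_gt0 n : (0 < loss n)%N.
Proof.
elim: n => // n IHn; rewrite lossS muln_gt0 IHn.
by case: ifP => // _; rewrite expn_gt0.
Qed.

Lemma loss_stage n : (loss n ^ (stage n).-1 <= 2 ^ n)%N.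
Proof.
elim: n => // n IHn; rewrite lossS stageS /triggered /trigger.
case: asboolP => [[cond _]|_].
  by rewrite addn1 (leq_trans cond)// leq_exp2l.
by rewrite muln1 addn0 (leq_trans IHn)// leq_exp2l.
Qed.

Hypothesis a_gt0 : forall k, (1 <= k)%N -> 0 < a k.
Hypothesis a_cvg0 : a k @[k --> \oo] --> (0 : R).

(** Once k is so large that [a k * (2 ^+ N * c) <= e], take the last n for which
    [a k * (2 ^+ n * c) <= e]; doubling once more exceeds [e]. *)
Lemma scale_hit (c e : R) N : 0 < c -> 0 < e ->
  exists n k, [/\ (N <= n)%N, (1 <= k)%N & e / 2 < a k * (2 ^+ n * c) <= e].
Proof.
move=> c0 e0.
have P0 m : 0 < 2 ^+ m :> R by rewrite exprn_gt0.
have d0 : 0 < e / (2 ^+ N * c) by rewrite divr_gt0// mulr_gt0.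
have /cvgrPdist_lt /(_ _ d0) [K _ /(_ (maxn K 1))/(_ (leq_maxl _ _))/=] := a_cvg0.
set k := maxn K 1; have k1 : (1 <= k)%N by exact: leq_maxr.
rewrite sub0r normrN gtr0_norm ?a_gt0// => ake.
have ak0 := a_gt0 k1.
have ex : exists n, e < a k * (2 ^+ n * c).
  exists (Num.truncn (e / (a k * c))).+1.
  rewrite mulrCA -ltr_pdivrMr ?mulr_gt0//.
  apply: lt_trans (truncnS_gt _) _.
  by rewrite -natrX ltr_nat ltn_expl.
case: (ex_minnP ex) => m mP mmin.
have Nm : (N < m)%N.
  rewrite ltnNge; apply/negP => mN; move: mP; apply/negP; rewrite -leNgt.
  move: ake; rewrite ltr_pdivlMr ?mulr_gt0// => /ltW; apply: le_trans.
  by rewrite ler_pM2l// ler_pM2r// ler_eXn2l// ltr1n.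
case: m Nm mP mmin => // m Nm mP mmin.
exists m, k; split => //; apply/andP; split.
  by move: mP; rewrite exprS; set x := 2 ^+ m; lra.
by rewrite leNgt; apply/negP => /mmin; rewrite ltnn.
Qed.

(** Every large radix gets used: as long as it waits, [loss] is constant, so
    the first condition of [trigger] eventually holds for good and the second
    holds for some later n by [scale_hit]. *)
Lemma stage_hit j : exists2 n, triggered n & stage n = j.
Proof.
suff reach i : exists n, stage n = i.
  have [n1 n1j] := reach j.+1.
  elim: n1 n1j => // n IHn; rewrite stageS.
  case: (boolP (triggered n)) => tn.
    by rewrite addn1 => -[<-]; exists n.
  by rewrite addn0; exact: IHn.
elim: i => [|i [N Ni]]; first by exists 0%N.
apply: contrapT => noS.
have stuck m : stage (m + N) = i /\ loss (m + N) = loss N.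
  elim: m => // m [sm lm]; rewrite addSn stageS lossS sm lm.
  case: (boolP (triggered (m + N))) => tn; last by rewrite addn0 muln1.
  by exfalso; apply: noS; exists (m + N).+1; rewrite stageS sm tn addn1.
have l0 : 0 < (loss N)%:R :> R by rewrite ltr0n loss_gt0.
have e0 : 0 < 2 ^- i :> R by rewrite invr_gt0 exprn_gt0.
pose B := ((loss N * 4 ^ i.+1) ^ i)%N.
have [n [k [Bn k1 hit]]] := scale_hit (maxn B N) l0 e0.
move: Bn; rewrite geq_max => /andP[Bn Nn].
apply: noS; exists n.+1; rewrite stageS.
have [sn ln] := stuck (n - N)%N; rewrite subnK// in sn ln.
suff -> : triggered n by rewrite sn addn1.
apply/asboolP; rewrite sn ln; split.
  by apply: leq_trans Bn _; exact/ltnW/ltn_expl.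
by exists k => //; rewrite natrM natrX exprS invfM mulrC in hit *.
Qed.

Lemma stage_nondecreasing : {homo stage : m n / (m <= n)%N}.
Proof.
apply: homo_leq => [//|x y z|n]; first exact: leq_trans.
by rewrite stageS leq_addr.
Qed.

(** Beyond the position where the stage exceeds m, [loss_stage] applies with
    exponent at least m; before it, [loss] is bounded. *)
Lemma loss_subexp m : exists C, forall n, (loss n ^ m <= C * 2 ^ n)%N.
Proof.
have [N _ Nm] := stage_hit m.+1.
have loss_mono : {homo loss : m n / (m <= n)%N}.
  apply: homo_leq => [//|x y z|n]; first exact: leq_trans.
  by rewrite lossS leq_pmulr//; case: ifP => // _; rewrite expn_gt0.
exists (loss N ^ m)%N => n; have [nN|/ltnW Nn] := leqP n N.
  apply: (@leq_trans (loss N ^ m)); last by rewrite leq_pmulr// expn_gt0.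
  have [->|m_gt0] := posnP m; first by rewrite !expn0.
  by rewrite leq_exp2r//; exact: loss_mono.
apply: (@leq_trans (2 ^ n)); last by rewrite leq_pmull// expn_gt0 loss_gt0.
apply: leq_trans (loss_stage n); apply: leq_pexp2l; first exact: loss_gt0.
by have := stage_nondecreasing Nn; rewrite Nm; case: (stage n).
Qed.

(** Q_n^s = 2^(n s) * loss^s, and if s <= m (1 - s) then
    loss^s <= (loss^m)^(1 - s) <= (C 2^n)^(1 - s). *)
Lemma denom_ratio_pow s : 0 <= s < 1 ->
  exists C : R, forall n, (denom ratio n)%:R `^ s <= C * 2 ^+ n.
Proof.
move=> /andP[s0 s1]; have t0 : 0 < 1 - s by rewrite subr_gt0.
pose m := (Num.truncn (s / (1 - s))).+1.
have ms : s <= m%:R * (1 - s).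
  by rewrite -ler_pdivrMr//; exact/ltW/truncnS_gt.
have [C CP] := loss_subexp m.
exists (C%:R `^ (1 - s)) => n; rewrite denom_ratio natrM powRM//.
have l1 : 1 <= (loss n)%:R :> R by rewrite ler1n loss_gt0.
have : (loss n)%:R `^ s <= C%:R `^ (1 - s) * (2 ^ n)%:R `^ (1 - s) :> R.
  apply: (@le_trans _ _ ((loss n)%:R `^ (m%:R * (1 - s)))).
    exact: ler_powR.
  rewrite powRrM powR_mulrn// -powRM// -natrX -natrM.
  by apply: ge0_ler_powR; rewrite ?nnegrE ?(ltW t0)// ler_nat.
move=> H.
apply: (@le_trans _ _ ((2 ^ n)%:R `^ s * (C%:R `^ (1 - s) * (2 ^ n)%:R `^ (1 - s)))).
  by apply: ler_wpM2l; rewrite ?powR_ge0.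
rewrite mulrCA -powRD; last by apply/implyP => _; rewrite pnatr_eq0 expn_eq0.
by rewrite [s + _]addrC subrK powRr1// natrX.
Qed.

(** At the position of a large radix of stage j, put e = 2^-j.  The hole is
    e^2 / 4 < |delta| a_k Q_n < 1 - e^2 / 4, and e / 2 < a_k Q_n <= e, so it is
    hit as soon as e < |delta| and 2 |delta| e < 1. *)
Lemma gap_set_avoids (x delta : R) : delta != 0 -> gap_set ratio x ->
  exists2 k, (1 <= k)%N & ~ gap_set ratio (x + delta * a k).
Proof.
move=> d0 Ex; have D0 : 0 < `|delta| by rewrite normr_gt0.
pose b := Num.max `|delta|^-1 (2 * `|delta|).
have [n tn nj] := stage_hit (Num.truncn b).+1.
have bn : b < 2 ^+ stage n.
  by apply: lt_trans (truncnS_gt _) _; rewrite -natrX ltr_nat nj ltn_expl.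
have := tn => /asboolP[_ [k k1 /andP[]]].
rewrite -denom_ratio => lo hie; exists k => // Ey.
have Q0 : 0 < (denom ratio n)%:R :> R by rewrite ltr0n denom_gt0//; exact: ratio_ge2.
set Q := (denom ratio n)%:R in Q0 lo hie.
pose e : R := 2 ^- stage n.
have e0 : 0 < e by rewrite invr_gt0 exprn_gt0.
have e1 : e <= 1 by rewrite invf_le1 ?exprn_gt0// exprn_ege1// ler1n.
have gapE : 2 / (denom ratio n.+1)%:R = e ^+ 2 / 4 / Q.
  rewrite denomS /ratio tn !natrM natrX -/Q /e.
  have -> : (4 ^+ (stage n).+1 : R) = 4 * (2 ^+ stage n) ^+ 2.
    by rewrite exprS -exprM mulnC exprM [2 ^+ 2]expr2 -natrM.
  field; rewrite !gt_eqF// exprn_gt0//.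
have := gap_set_dist ratio_ge2 n Ex Ey; rewrite addrAC subrr add0r normrM gapE.
rewrite (gtr0_norm (a_gt0 k1)) -/Q.
have loe : e / 2 < a k * Q by move: lo; rewrite exprS invfM mulrC.
have eD : e < `|delta|.
  rewrite /e -[ltRHS]invrK ltf_pV2 ?posrE ?exprn_gt0 ?invr_gt0//.
  by apply: le_lt_trans bn; rewrite le_max lexx.
have De : 2 * `|delta| * e < 1.
  rewrite /e ltr_pdivrMr ?exprn_gt0// mul1r.
  by apply: le_lt_trans bn; rewrite le_max lexx orbT.
rewrite -/e in hie.
case; apply/negP; rewrite -ltNge.
  by rewrite ltr_pdivrMr// -mulrA; nra.
rewrite -[X in X - _]mul1r -mulrBl ltr_pdivlMr// -mulrA; nra.
Qed.

End Scales.

(** * The avoiding set *)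

(* [measurable] on a [realType] is the Borel sigma-algebra. *)
Theorem corollary1p2 (R : realType) (a phi : nat -> R)
  (a_null : null_sequence a)
  (a_log : forall n, (1 <= n)%N -> ln (a n / a n.+1) = expR (phi n))
  (phi_incr : forall m n, (1 <= m)%N -> (m < n)%N -> phi m < phi n)
  (phi_sublinear : phi n / n%:R @[n --> \oo] --> (0 : R)) :
  exists E : set R,
    [/\ measurable E,
        hausdorff_dim E = 1%E
      & ~ contains_nontrivial_affine_copy E (seq_range a `|` [set 0])].
Proof.
have [a_gt0 _ a_cvg0] := a_null.
exists (gap_set (ratio a)); split.
- exact: measurable_gap_set.
- apply/eqP; rewrite eq_le hausdorff_dim_le1 ?andTb; last by move=> x [].
  apply: (@hausdorff_dim_ge1 _ _ (digit_map (ratio a))) => [u|s s01].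
    by apply: digit_map_gap_set; exact: ratio_ge2.
  have [C CP] := denom_ratio_pow a_gt0 a_cvg0 s01.
  have /andP[s0 _] := s01.
  by exists (4 * C); apply: digit_map_holder CP => //; exact: ratio_ge2.
- move=> [x [delta [delta0 copy]]].
  have Ex : gap_set (ratio a) x.
    by apply: copy; exists 0; [right|rewrite mulr0 addr0].
  have [k k1] := gap_set_avoids a_gt0 a_cvg0 delta0 Ex.
  by apply; apply: copy; exists (a k) => //; left; exists k.
Qed.
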